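(* For every integer $m\ge 2$, $$B(f_{m}-2)=\frac{m-3}{5}f_{m+2}+\frac{m-1}{5}f_{m}+2.$$
   Context: The Fibonacci sequence $\mathbb{F}$ is the infinite word over $\{a,b\}$ that begins with $a$ and is fixed by the morphism $\sigma$ with $\sigma(a)=ab$, $\sigma(b)=a$. Letters are indexed from $1$; $\mathbb{F}[i,j]$ is the factor from the $i$-th to the $j$-th letter. The Fibonacci numbers are $f_{-1}=f_0=1$, $f_{k+1}=f_k+f_{k-1}$ for $k\ge 0$ (so $f_1=2$, $f_2=3$, $f_3=5$). A palindrome is a nonempty finite word equal to its reversal. For $n\ge 1$, $A(n)$ is the number of palindrome occurrences ending at position $n$, i.e. the number of $i\in\{1,\dots,n\}$ such that $\mathbb{F}[i,n]$ is a palindrome, and $B(n)=\sum_{i=1}^n A(i)$ is the number of repeated palindrome occurrences in $\mathbb{F}[1,n]$. *)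

(* Defs.v *)
From HB Require Import structures.
From mathcomp Require Import all_boot.

Set Implicit Arguments.
Unset Strict Implicit.
Unset Printing Implicit Defensive.

Inductive letter := la | lb.

Definition bool_of_letter (x : letter) : bool := if x is la then true else false.
Definition letter_of_bool (b : bool) : letter := if b then la else lb.

Lemma bool_of_letterK : cancel bool_of_letter letter_of_bool.
Proof. by case. Qed.

HB.instance Definition _ := Equality.copy letter (can_type bool_of_letterK).

Definition sigma_letter (x : letter) : seq letter :=
  if x is la then [:: la; lb] else [:: la].

Definition sigma (s : seq letter) : seq letter := flatten (map sigma_letter s).

(* An infinite word is a function w : nat -> letter whose i-th letter, i >= 1,
   is w i; the value w 0 is meaningless and never used. *)

(* The factor w[i,j]; it is empty when j < i. *)
Definition factor (w : nat -> letter) (i j : nat) : seq letter :=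
  map w (index_iota i j.+1).

(* The image of an infinite word. As sigma does not erase letters, sigma(w[1,i])
   has at least i letters and so contains the i-th letter of the image: the
   default value of nth is not reached for i >= 1. *)
Definition sigma_inf (w : nat -> letter) (i : nat) : letter :=
  nth la (sigma (factor w 1 i)) i.-1.

Definition fibonacci_word (w : nat -> letter) : Prop :=
  w 1 = la /\ forall i, 0 < i -> sigma_inf w i = w i.

(* f_0 = 1 and f_1 = f_0 + f_{-1} = 2; f_{-1} = 1 itself is not represented. *)
Fixpoint fib (k : nat) : nat :=
  match k with
  | 0 => 1
  | 1 => 2
  | (k'.+1 as k1).+1 => fib k1 + fib k'
  end.

Definition palindrome (s : seq letter) : bool := (s != [::]) && (rev s == s).

Definition pal_ending (w : nat -> letter) (n : nat) : nat :=
  count (fun i => palindrome (factor w i n)) (index_iota 1 n.+1).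

Definition pal_total (w : nat -> letter) (n : nat) : nat :=
  \sum_(1 <= i < n.+1) pal_ending w i.

(* There is exactly one Fibonacci word, up to the meaningless value at 0. *)

Lemma sigma_cat s t : sigma (s ++ t) = sigma s ++ sigma t.
Proof. by rewrite /sigma map_cat flatten_cat. Qed.

Lemma size_sigma s : size s <= size (sigma s).
Proof.
by elim: s => // x s IHs; rewrite /sigma /= size_cat; case: x => //=; apply: ltnW.
Qed.

Lemma size_sigma_la s : (size s).+1 < size (sigma (la :: s)).
Proof. by rewrite /sigma /= !ltnS size_sigma. Qed.

Lemma size_factor1 w n : size (factor w 1 n) = n.
Proof. by rewrite size_map size_iota subn1. Qed.

Lemma fibonacci_word_uniq w w' : fibonacci_word w -> fibonacci_word w' ->
  forall i, 0 < i -> w i = w' i.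
Proof.
move=> [w1 fix_w] [w'1 fix_w'].
have step u k : u 1 = la ->
    sigma_inf u k.+2 = nth la (sigma (factor u 1 k.+1)) k.+1.
  move=> u1; rewrite /sigma_inf.
  have -> : factor u 1 k.+2 = factor u 1 k.+1 ++ [:: u k.+2].
    by rewrite /factor /index_iota !subn1 !succnK -{1}(addn1 k.+1) iotaD map_cat.
  rewrite sigma_cat nth_cat.
  have -> // : k.+1 < size (sigma (factor u 1 k.+1)).
  have := size_sigma_la (map u (iota 2 k)).
  by rewrite size_map size_iota -u1.
elim/ltn_ind=> -[|[|k]] IH // _; first by rewrite w1.
rewrite -fix_w // -fix_w' // !step //; congr (nth _ (sigma _) _).
by apply/eq_in_map=> i; rewrite mem_index_iota => /andP[i0 ik]; apply: IH.
Qed.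

Lemma fibonacci_word_exists : exists w, fibonacci_word w.
Proof.
pose s n := iter n sigma [:: la].
have sS n : exists t, s n.+1 = s n ++ t.
  elim: n => [|n [t IHn]]; first by exists [:: lb].
  by exists (sigma t); rewrite -sigma_cat -IHn.
have s_la n : exists t, s n = la :: t.
  elim: n => [|n [t IHn]]; first by exists [::].
  by have [t' ->] := sS n; exists (t ++ t'); rewrite IHn.
have size_s n : n < size (s n).
  elim: n => // n IHn; have [t def_s] := s_la n.
  rewrite /s iterS -/(s n) def_s; apply: leq_trans (size_sigma_la t).
  by rewrite def_s in IHn.
have s_le m n : m <= n -> exists t, s n = s m ++ t.
  move=> /subnKC <-; elim: (n - m) => [|d [t IHd]].
    by exists [::]; rewrite addn0 cats0.
  by rewrite addnS; have [t' ->] := sS (m + d); exists (t ++ t'); rewrite IHd catA.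
pose w i := nth la (s i) i.-1.
have w_prefix n : factor w 1 n = take n (s n).
  apply: (@eq_from_nth _ la) => [|i].
    by rewrite size_factor1 size_takel // ltnW.
  rewrite size_factor1 => lt_in; rewrite nth_take //.
  rewrite (nth_map 0) ?size_iota ?subn1 // nth_iota ?subn1 // add1n /w /=.
  have [t ->] := s_le _ _ lt_in.
  by rewrite nth_cat (ltn_trans (ltnSn i) (size_s i.+1)).
exists w; split=> // -[//|i] _.
rewrite /sigma_inf w_prefix /= /w /=.
have size_i : i < size (sigma (take i.+1 (s i.+1))).
  by apply: leq_trans (size_sigma _); rewrite size_takel // ltnW.
have [t def_s] := sS i.+1.
have : sigma (s i.+1) = s i.+1 ++ t by rewrite -def_s.
rewrite -{1}(cat_take_drop i.+1 (s i.+1)) sigma_cat.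
move/(congr1 (fun u => nth la u i)).
by rewrite !nth_cat size_i (ltn_trans (ltnSn i) (size_s i.+1)).
Qed.

(* Main.v *)
Require Import Defs.
From mathcomp Require Import all_boot all_order all_algebra.
From mathcomp Require Import zify ring.

(** The Fibonacci prefixes of length [fib m - 2] form the chain
    [[::], a, aba, abaaba, ...] in which each word [x] is followed by
    [sigma x ++ [:: la]] ([factor_central]), and the palindromes of
    [sigma x ++ [:: la]] are governed by those of [x], whatever the word [x] is.

    Indeed [sigma] reverses well once a letter [a] is added: the reversal of
    [sigma u ++ [:: la]] is [sigma (rev u) ++ [:: la]]. An occurrence in
    [sigma x ++ [:: la]] of a word that begins and ends with [a] is
    [sigma u ++ [:: la]] for exactly one occurrence of a possibly empty word [u]
    in [x], and it is a palindrome if and only if [u] is empty or a palindrome.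
    An occurrence of a palindrome [v] that begins and ends with [b] always sits
    between two letters [a], and [la :: v ++ [:: la]] is
    [sigma u ++ [:: la]] for a palindrome [u] that begins with [a]. Hence, with
    [N] the number of palindrome occurrences and [Na] the number of those that
    begin with [a],
      [Na (sigma x ++ [:: la]) = N x + size x + 1]
      [N (sigma x ++ [:: la]) = N x + size x + 1 + Na x]
    ([pal_occ_la_ext], [pal_occ_ext]). Two consecutive steps of the chain give
    the linear recurrence [N_(m+2) = N_(m+1) + N_m + fib (m + 2) - 2], where [N_m]
    counts the occurrences in the prefix of length [fib m - 2]; the closed formula
    satisfies it.

    An occurrence is located by the suffix of [x] at its first letter and by its
    being a prefix of that suffix, so that both identities are proved by
    induction on [x]. *)

Set Implicit Arguments.
Unset Strict Implicit.
Unset Printing Implicit Defensive.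

Import GRing.Theory.

(** * Palindromes under the Fibonacci morphism *)

Lemma sigma_cons x s : sigma (x :: s) = sigma_letter x ++ sigma s.
Proof. by []. Qed.

Lemma rev_sigma_la s : rev (sigma s ++ [:: la]) = sigma (rev s) ++ [:: la].
Proof.
elim: s => // x s IHs.
rewrite sigma_cons -catA rev_cat IHs rev_cons -cats1 sigma_cat -!catA.
by case: x.
Qed.

Lemma sigma_inj : injective sigma.
Proof.
(* The image of a nonempty word begins with a, so that a letter b after the
   first a tells which letter was substituted. *)
elim=> [|x s IHs] [|y t]; rewrite ?sigma_cons //; try by case: x.
  by case: y.
case: x; case: y => //=.
- by case=> /IHs->.
- by case: t => // -[].
- by case: s {IHs} => // -[].
- by case=> /IHs->.
Qed.

Lemma palindrome_sigma_la s :
  palindrome (sigma s ++ [:: la]) = (rev s == s).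
Proof.
rewrite /palindrome rev_sigma_la -size_eq0 size_cat addn1 /=.
by rewrite !cats1 (inj_eq (@rcons_injl _ la)) (inj_eq sigma_inj).
Qed.

Lemma palindrome_cons_rcons x s :
  s != [::] -> palindrome (x :: rcons s x) = palindrome s.
Proof.
move=> s0; rewrite /palindrome s0 /= rev_cons rev_rcons /= eqseq_cons eqxx /=.
by rewrite (inj_eq (@rcons_injl _ x)).
Qed.

Lemma palindrome_cons_rconsF x y s :
  x != y -> palindrome (x :: rcons s y) = false.
Proof.
move=> /negPf xy; rewrite /palindrome rev_cons rev_rcons /=.
by rewrite eqseq_cons eq_sym xy.
Qed.

Lemma palindrome_cons_la s :
  palindrome (la :: s) = palindrome (lb :: sigma s).
Proof.
rewrite -(@palindrome_cons_rcons la (lb :: sigma s)) //.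
by rewrite -cats1 -[la :: _ ++ _]/(sigma (la :: s) ++ [:: la]) palindrome_sigma_la.
Qed.

(** * Prefixes of an image *)

Fixpoint prefixes (T : Type) (s : seq T) : seq (seq T) :=
  [::] :: (if s is x :: t then map (cons x) (prefixes t) else [::]).

Lemma count_prefixes_cons (T : Type) (q : pred (seq T)) x s :
  count q (prefixes (x :: s)) = q [::] + count (fun u => q (x :: u)) (prefixes s).
Proof. by rewrite /= count_map. Qed.

(** A prefix of [sigma x ++ [:: la]] ending with [a] stops just after the first
    letter of the block that follows [sigma u], with [u] a prefix of [x]; the
    added letter plays this part when [u] is the whole of [x]. *)
Lemma count_prefixes_end_la (q : pred (seq letter)) x :
    (forall u, q (rcons u lb) = false) ->
  count q (prefixes (sigma x ++ [:: la])) =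
    q [::] + count (fun u => q (sigma u ++ [:: la])) (prefixes x).
Proof.
elim: x q => [|y x IHx] q qb; first by rewrite /= !addn0.
rewrite sigma_cons -catA [in RHS]count_prefixes_cons.
case: y; rewrite [_ ++ (_ ++ _)]/= !count_prefixes_cons IHx //.
- by rewrite (qb [:: la]) add0n.
- by move=> u; rewrite -!rcons_cons.
- by move=> u; rewrite -rcons_cons.
Qed.

(** A prefix of [sigma x ++ [:: la]] ending with [b] ends with a whole block. *)
Lemma count_prefixes_end_lb (q : pred (seq letter)) x :
    (forall u, q (rcons u la) = false) ->
  count q (prefixes (sigma x ++ [:: la])) =
    count (fun u => q (sigma u)) (prefixes x).
Proof.
elim: x q => [|y x IHx] q qa; first by rewrite /= (qa [::]).
rewrite sigma_cons -catA [in RHS]count_prefixes_cons.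
case: y; rewrite [_ ++ (_ ++ _)]/= !count_prefixes_cons IHx //.
- by rewrite (qa [::]) add0n.
- by move=> u; rewrite -!rcons_cons.
- by move=> u; rewrite -rcons_cons.
Qed.

(** * Palindrome occurrences in an image *)

Definition pal_prefixes (s : seq letter) : nat := count palindrome (prefixes s).

Lemma sigma_la_head x : exists t, sigma x ++ [:: la] = la :: t.
Proof. by case: x => [|[] x]; eexists. Qed.

(** The empty prefix of [x] accounts for the palindrome [a]. *)
Lemma pal_prefixes_la x :
  pal_prefixes (sigma x ++ [:: la]) = (pal_prefixes x).+1.
Proof.
have -> : pal_prefixes (sigma x ++ [:: la]) =
    count (fun u => palindrome u && (last la u == la))
      (prefixes (sigma x ++ [:: la])).
  have [t ->] := sigma_la_head x.
  rewrite /pal_prefixes !count_prefixes_cons; congr (_ + _).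
  apply: eq_count => u; case: (lastP u) => //= v [] /=; rewrite last_rcons ?andbT //.
  by rewrite palindrome_cons_rconsF.
rewrite count_prefixes_end_la => [|u]; last by rewrite last_rcons andbF.
rewrite add0n /pal_prefixes.
under eq_count => u do rewrite last_cat eqxx andbT palindrome_sigma_la.
by case: x => // y x; rewrite !count_prefixes_cons.
Qed.

(** Writing [b] before [sigma u] is the same as removing both outer letters [a]
    of [sigma (la :: u) ++ [:: la]], which preserves being a palindrome. *)
Lemma pal_prefixes_lb x :
  pal_prefixes (lb :: sigma x ++ [:: la]) = pal_prefixes (la :: x).
Proof.
rewrite /pal_prefixes !count_prefixes_cons count_prefixes_end_lb => [|u].
  by congr (_ + _); apply: eq_count => u; rewrite palindrome_cons_la.
exact: palindrome_cons_rconsF.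
Qed.

(** The occurrences in [s] of palindromes whose first letter satisfies [P]. *)
Fixpoint pal_occ (P : pred letter) (s : seq letter) : nat :=
  if s is x :: t then P x * pal_prefixes s + pal_occ P t else 0.

(** The suffixes of [sigma (y :: x) ++ [:: la]] that begin with [a] are that word
    and the similar ones of [sigma x ++ [:: la]], so that each letter of [x] opens
    one of them; the last one, a single [a], adds the final 1. *)
Lemma pal_occ_la_ext x :
  pal_occ (pred1 la) (sigma x ++ [:: la]) = pal_occ predT x + size x + 1.
Proof.
elim: x => // y x IHx.
have e : pal_prefixes (sigma (y :: x) ++ [:: la]) = (pal_prefixes (y :: x)).+1.
  exact: pal_prefixes_la.
by case: y e => /= ->; rewrite IHx !(mul0n, mul1n); lia.
Qed.

(** One suffix begins with [b] for each letter [a] of [x]. *)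
Lemma pal_occ_ext x :
  pal_occ predT (sigma x ++ [:: la]) =
    pal_occ predT x + size x + 1 + pal_occ (pred1 la) x.
Proof.
elim: x => // y x IHx.
have e : pal_prefixes (sigma (y :: x) ++ [:: la]) = (pal_prefixes (y :: x)).+1.
  exact: pal_prefixes_la.
by case: y e => /= ->; rewrite ?pal_prefixes_lb IHx !(mul0n, mul1n);
  move: (pal_occ (pred1 la) x) => p; lia.
Qed.

(** * Counting by first letters *)

Lemma factor_cons (w : nat -> letter) i j :
  i <= j -> factor w i j = w i :: factor w i.+1 j.
Proof. by move=> ij; rewrite /factor /index_iota subSn. Qed.

Lemma factor_nil (w : nat -> letter) i : factor w i.+1 i = [::].
Proof. by rewrite /factor /index_iota subnn. Qed.

Lemma count_prefixes_factor (w : nat -> letter) (q : pred (seq letter)) i d :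
  count q (prefixes (factor w i.+1 (i + d))) =
    \sum_(i <= j < (i + d).+1) q (factor w i.+1 j).
Proof.
elim: d i q => [|d IHd] i q.
  by rewrite addn0 factor_nil big_nat1 factor_nil /= addn0.
rewrite factor_cons ?addnS ?ltnS ?leq_addr // count_prefixes_cons -addSn IHd.
rewrite [in RHS]big_nat_recl; last by rewrite addSn -addnS leq_addr.
rewrite factor_nil; congr (_ + _).
rewrite big_add1 /=; apply: eq_big_nat => j /andP[ij _].
by rewrite (factor_cons w (i := i.+1)).
Qed.

Lemma pal_prefixes_factor (w : nat -> letter) i n : 0 < i -> i <= n.+1 ->
  pal_prefixes (factor w i n) = \sum_(i <= j < n.+1) palindrome (factor w i j).
Proof.
case: i => // i _; rewrite ltnS => /subnKC <-.
rewrite /pal_prefixes count_prefixes_factor big_ltn ?ltnS ?leq_addr //.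
by rewrite factor_nil add0n.
Qed.

Lemma pal_occ_factor (w : nat -> letter) i n : 0 < i -> i <= n.+1 ->
  pal_occ predT (factor w i n) =
    \sum_(i <= k < n.+1) \sum_(k <= j < n.+1) palindrome (factor w k j).
Proof.
move=> i0 /subnKC; move: (n.+1 - i) => d.
elim: d i i0 => [|d IHd] i i0 def_n.
  by rewrite -def_n addn0 big_geq // -[i]addn0 def_n factor_nil.
have le_in : i <= n by lia.
rewrite big_ltn // -IHd ?addSnnS // -pal_prefixes_factor // 1?ltnW //.
by rewrite factor_cons //= mul1n.
Qed.

(** Ending positions are exchanged with starting positions. *)
Lemma pal_totalE (w : nat -> letter) n :
  pal_total w n = pal_occ predT (factor w 1 n).
Proof.
rewrite pal_occ_factor // /pal_total /pal_ending.
transitivity (\sum_(1 <= j < n.+1) \sum_(1 <= i < n.+1 | i <= j)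
                palindrome (factor w i j)).
  apply: eq_big_nat => j /andP[_ jn].
  by rewrite -sum1_count big_mkcond (@big_nat_widen _ _ _ 1 j.+1 n.+1) //.
rewrite (exchange_big_dep_nat xpredT) //=.
apply: eq_big_nat => i /andP[i1 _].
by rewrite [RHS](@big_nat_widenl _ _ _ i 1).
Qed.

(** * The palindromic prefixes of the Fibonacci word *)

(** The central words of the Fibonacci word: [central k] is its prefix of
    length [fib k.+1 - 2]. *)
Definition central (k : nat) : seq letter :=
  iter k (fun s => sigma s ++ [:: la]) [::].

Lemma size_sigma_sigma_la s :
  size (sigma (sigma s ++ [:: la])) = size (sigma s) + size s + 2.
Proof.
elim: s => // x s IHs; rewrite sigma_cons -catA sigma_cat !size_cat IHs.
by case: x => /=; lia.
Qed.

(** Both sides satisfy the Fibonacci recurrence, since [sigma] lengthens a word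
    by its number of letters [a], and [sigma s] has as many of them as [s] has
    letters. *)
Lemma size_central k : fib k.+1 = size (central k) + 2.
Proof.
suff: fib k.+1 = size (central k) + 2 /\ fib k.+2 = size (central k.+1) + 2.
  by case.
elim: k => // k [IH1 IH2]; split=> //.
rewrite [LHS]/= -/(fib k.+2) -/(fib k.+1) IH1 IH2 /= !size_cat size_sigma_sigma_la.
by rewrite /=; lia.
Qed.

Lemma factor_rcons (w : nat -> letter) n :
  factor w 1 n.+1 = rcons (factor w 1 n) (w n.+1).
Proof.
by rewrite /factor /index_iota !subn1 -map_rcons -cats1 -(iotaD 1 n 1) addn1.
Qed.

(** The images of the prefixes of [F] are prefixes of one another, so the
    fixed-point equation can be read in any of them that is long enough. *)
Lemma nth_sigma_factor (F : nat -> letter) (hF : fibonacci_word F) n i :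
  i < size (sigma (factor F 1 n)) -> nth la (sigma (factor F 1 n)) i = F i.+1.
Proof.
have [_ <-] := hF; rewrite // /sigma_inf [_.-1]/=.
have mono p d : exists t, sigma (factor F 1 (p + d)) = sigma (factor F 1 p) ++ t.
  elim: d => [|d [t IHd]]; first by exists [::]; rewrite addn0 cats0.
  rewrite addnS factor_rcons -cats1 sigma_cat IHd -catA; by eexists.
have lt_i : i < size (sigma (factor F 1 i.+1)).
  by apply: leq_trans (size_sigma _); rewrite size_factor1.
case: (leqP n i.+1) => [|/ltnW] /subnKC e lt_n.
- by have [t] := mono n (i.+1 - n); rewrite e => ->; rewrite nth_cat lt_n.
- by have [t] := mono i.+1 (n - i.+1); rewrite e => ->; rewrite nth_cat lt_i.
Qed.

(** The added letter is the first one of the next block. *)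
Lemma factor_sigma_la (F : nat -> letter) (hF : fibonacci_word F) n s :
  factor F 1 n = s -> factor F 1 (size (sigma s)).+1 = sigma s ++ [:: la].
Proof.
move=> <-; set s' := sigma _ ++ _.
have [t def_t] : exists t, sigma (factor F 1 n.+1) = s' ++ t.
  rewrite factor_rcons -cats1 sigma_cat /s'.
  by case: (F n.+1); [exists [:: lb] | exists [::]]; rewrite -catA.
have size_s' : (size (sigma (factor F 1 n))).+1 = size s' by rewrite size_cat addn1.
rewrite size_s'; apply: (@eq_from_nth _ la) => [|i]; rewrite size_factor1 // => lt_i.
rewrite (nth_map 0) ?size_iota ?subn1 // nth_iota ?subn1 // add1n.
rewrite -(nth_sigma_factor hF (n := n.+1)) def_t ?nth_cat ?lt_i //.
by rewrite size_cat ltn_addr.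
Qed.

Lemma factor_central (F : nat -> letter) (hF : fibonacci_word F) k :
  factor F 1 (size (central k)) = central k.
Proof.
elim: k => // k IHk; rewrite [central _]/= size_cat addn1.
exact: (factor_sigma_la hF IHk).
Qed.

(** * Solving the recurrence *)

(** The occurrences beginning with [a] are eliminated by applying both extension
    formulas in succession. *)
Lemma pal_occ_central_rec k :
  pal_occ predT (central k.+2) =
    pal_occ predT (central k.+1) + pal_occ predT (central k) +
    size (central k.+2).
Proof.
rewrite [central k.+2]/= pal_occ_ext -[sigma _ ++ _]/(central k.+1).
rewrite [in pal_occ (pred1 la) _]/= pal_occ_la_ext.
have := size_central k.+2; have := size_central k.+1; have := size_central k.
rewrite [fib k.+3]/= -/(fib k.+2) -/(fib k.+1) => -> -> /=; lia.
Qed.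

Local Open Scope ring_scope.

Lemma fibR_rec k : (fib k.+2)%:R = (fib k.+1)%:R + (fib k)%:R :> rat.
Proof. by rewrite -natrD. Qed.

Lemma pal_occ_centralE k :
  (pal_occ predT (central k))%:R =
    (k%:R - 2) / 5 * (fib k.+3)%:R + k%:R / 5 * (fib k.+1)%:R + 2 :> rat.
Proof.
elim/ltn_ind: k => -[|[|k]] IH; try by apply/eqP.
have size_k : (size (central k.+2))%:R = (fib k.+3)%:R - 2 :> rat.
  by rewrite size_central natrD addrK.
rewrite pal_occ_central_rec 2!natrD size_k !IH // ?ltnW //.
by rewrite !fibR_rec -(natr1 k.+1) -(natr1 k); field.
Qed.

Theorem mainTheorem7 (F : nat -> letter) (hF : fibonacci_word F)
    (m : nat) (hm : (2 <= m)%N) :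
  (pal_total F (fib m - 2)%N)%:R =
    (m%:R - 3) / 5 * (fib (m + 2)%N)%:R
    + (m%:R - 1) / 5 * (fib m)%:R + 2 :> rat.
Proof.
case: m hm => // k _.
rewrite pal_totalE {1}size_central addnK (factor_central hF) pal_occ_centralE.
by rewrite addn2 -(natr1 k); field.
Qed.
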